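(* Let $\mathcal{L}$ be a finite-dimensional complex Lie algebra with $\dim\mathcal{L}\geq2$. Then $\mathcal{L}$ is subsimple if and only if it is either simple, or isomorphic to a Lie algebra from class $\mathbf{(I)}$ or class $\mathbf{(II)}$. More precisely, let $\mathcal{L}$ be subsimple: if $\mathcal{L}$ is semisimple and not simple, it is isomorphic to a Lie algebra in class $\mathbf{(I)}$; if $\mathcal{L}$ is neither simple nor semisimple, it is isomorphic to a Lie algebra in class $\mathbf{(II)}$.
   Context: A finite-dimensional Lie algebra $\mathcal{L}$ is subsimple if either $\dim\mathcal{L}=1$ or $\mathcal{L}$ has a proper maximal Lie subalgebra that contains no non-zero Lie ideals of $\mathcal{L}$. Class $\mathbf{(I)}$ consists of the Lie algebras $N\oplus N$ (direct sum), where $N$ is a (finite-dimensional) simple Lie algebra. Class $\mathbf{(II)}$ consists of the Lie algebras $N\oplus^{\mathrm{id}}X$, where $X$ is a finite-dimensional complex vector space and $N$ is a Lie algebra of operators on $X$ which has no non-trivial invariant subspaces in $X$. Here $N\oplus^{\mathrm{id}}X$ is the semidirect product: the vector space of pairs $(a;x)$, $a\in N$, $x\in X$, with bracket $[(a;x),(b;y)]=([a,b];\,ay-bx)$. A finite-dimensional Lie algebra is semisimple if it has no non-zero commutative Lie ideals. *)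

(* Defs.v *)
From HB Require Import structures.
From mathcomp Require Import all_boot all_order all_algebra.
From mathcomp Require Import reals complex.

Set Implicit Arguments.
Unset Strict Implicit.
Unset Printing Implicit Defensive.

Import GRing.Theory.
Local Open Scope ring_scope.

HB.mixin Record Vector_isLieAlgebra (F : fieldType) (L : Type)
    of Vector F L := {
  bracket : L -> L -> L;
  bracket_linearl : forall y : L, linear (fun x => bracket x y);
  bracket_linearr : forall x : L, linear (bracket x);
  bracketxx : forall x : L, bracket x x = 0;
  jacobi : forall x y z : L,
    bracket x (bracket y z) + bracket y (bracket z x)
      + bracket z (bracket x y) = 0
}.

(* Since Lie algebras are built on vectType, they are finite-dimensional. *)
#[short(type="lieAlgType")]
HB.structure Definition LieAlgebra (F : fieldType) :=
  { L of Vector_isLieAlgebra F L & Vector F L }.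

Notation "[ 'lie' x , y ]" := (bracket x y)
  (at level 0, x, y at level 99, format "[ 'lie'  x ,  y ]") : ring_scope.

Section LieNotions.
Variables (F : fieldType) (L : lieAlgType F).
Implicit Types (U M : {vspace L}).

Definition is_subalgebra U : Prop :=
  forall x y : L, x \in U -> y \in U -> [lie x, y] \in U.

Definition is_ideal U : Prop :=
  forall x y : L, y \in U -> [lie x, y] \in U.

Definition commutative_on U : Prop :=
  forall x y : L, x \in U -> y \in U -> [lie x, y] = 0.

Definition is_maximal_subalgebra M : Prop :=
  [/\ is_subalgebra M, M <> fullv &
      forall K : {vspace L}, is_subalgebra K -> (M <= K)%VS ->
        K = M \/ K = fullv].

(* Simple algebras are required to be non-commutative, so that a
   one-dimensional Lie algebra is not simple. *)
Definition is_simple : Prop :=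
  ~ commutative_on fullv /\
  forall U, is_ideal U -> U = 0%VS \/ U = fullv.

Definition is_semisimple : Prop :=
  forall U, is_ideal U -> commutative_on U -> U = 0%VS.

Definition is_subsimple : Prop :=
  \dim {: L} = 1%N \/
  exists M, is_maximal_subalgebra M /\
    forall U, is_ideal U -> (U <= M)%VS -> U = 0%VS.

End LieNotions.
Arguments is_simple {F} L.
Arguments is_semisimple {F} L.
Arguments is_subsimple {F} L.

Definition lie_isomorphic (F : fieldType) (L M : lieAlgType F) : Prop :=
  exists f : {linear L -> M},
    bijective f /\ forall x y : L, f [lie x, y] = [lie f x, f y].

Section DirectSum.
Variables (F : fieldType) (L M : lieAlgType F).
Implicit Types u v w : (L * M)%type.

Definition dsum_bracket u v : L * M := ([lie u.1, v.1], [lie u.2, v.2]).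

Lemma dsum_linearl v : linear (fun u => dsum_bracket u v).
Proof.
by move=> a u w; rewrite /dsum_bracket /= !bracket_linearl.
Qed.

Lemma dsum_linearr u : linear (dsum_bracket u).
Proof.
by move=> a v w; rewrite /dsum_bracket /= !bracket_linearr.
Qed.

Lemma dsum_xx u : dsum_bracket u u = 0.
Proof. by rewrite /dsum_bracket !bracketxx. Qed.

Lemma dsum_jacobi u v w :
  dsum_bracket u (dsum_bracket v w) + dsum_bracket v (dsum_bracket w u)
    + dsum_bracket w (dsum_bracket u v) = 0.
Proof. by congr pair; apply: jacobi. Qed.

HB.instance Definition _ := Vector_isLieAlgebra.Build F (L * M)%type
  dsum_linearl dsum_linearr dsum_xx dsum_jacobi.

End DirectSum.

Fact jacobi_cancel (V : zmodType) (p q r s t u : V) :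
  p - q - (r - s) + (r - t - (u - q)) + (u - s - (p - t)) = 0.
Proof.
have E (x y z w : V) : x - y - (z - w) = (x + w) - (y + z).
  by rewrite opprB addrACA -opprD.
by rewrite !E (addrC r) (addrC u) (addrC s) subrKA subrKA subrr.
Qed.

Section GeneralLinear.
Variables (F : fieldType) (X : vectType F).
Implicit Types a b c : 'End(X).

Definition commutator a b : 'End(X) := (a \o b)%VF - (b \o a)%VF.

Lemma commutator_linearl b : linear (fun a => commutator a b).
Proof.
move=> k a c; rewrite /commutator comp_lfunDl comp_lfunDr -comp_lfunZl.
by rewrite -comp_lfunZr scalerBr opprD addrACA.
Qed.

Lemma commutator_linearr a : linear (commutator a).
Proof.
move=> k b c; rewrite /commutator comp_lfunDl comp_lfunDr -comp_lfunZl.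
by rewrite -comp_lfunZr scalerBr opprD addrACA.
Qed.

Lemma commutatorxx a : commutator a a = 0.
Proof. exact: subrr. Qed.

Lemma commutator_jacobi a b c :
  commutator a (commutator b c) + commutator b (commutator c a)
    + commutator c (commutator a b) = 0.
Proof.
rewrite /commutator !(comp_lfunDl, comp_lfunDr, comp_lfunNl, comp_lfunNr).
by rewrite !comp_lfunA jacobi_cancel.
Qed.

HB.instance Definition _ := Vector_isLieAlgebra.Build F 'End(X)
  commutator_linearl commutator_linearr commutatorxx commutator_jacobi.

End GeneralLinear.

Section Subalgebra.
Variables (F : fieldType) (L : lieAlgType F).

Record lieSubalg := LieSubalg {
  lieSubalg_space :> {vspace L};
  lieSubalgP : is_subalgebra lieSubalg_space
}.

Definition lieSubalg_of (N : lieSubalg) : Type := subvs_of N.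

HB.instance Definition _ (N : lieSubalg) :=
  Vector.copy (lieSubalg_of N) (subvs_of N).

Variable N : lieSubalg.
Implicit Types u v w : lieSubalg_of N.

Definition sub_bracket u v : lieSubalg_of N :=
  Subvs (lieSubalgP (subvsP u) (subvsP v)).

Lemma sub_linearl v : linear (fun u => sub_bracket u v).
Proof. by move=> a u w; apply: val_inj; rewrite /= bracket_linearl. Qed.

Lemma sub_linearr u : linear (sub_bracket u).
Proof. by move=> a v w; apply: val_inj; rewrite /= bracket_linearr. Qed.

Lemma sub_xx u : sub_bracket u u = 0.
Proof. by apply: val_inj; rewrite /= bracketxx. Qed.

Lemma sub_jacobi u v w :
  sub_bracket u (sub_bracket v w) + sub_bracket v (sub_bracket w u)
    + sub_bracket w (sub_bracket u v) = 0.
Proof. by apply: val_inj; rewrite /= jacobi. Qed.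

HB.instance Definition _ := Vector_isLieAlgebra.Build F (lieSubalg_of N)
  sub_linearl sub_linearr sub_xx sub_jacobi.

End Subalgebra.

Notation operatorLieAlg X := (lieSubalg 'End(X)).

Section Semidirect.
Variables (F : fieldType) (X : vectType F) (N : operatorLieAlg X).

Definition is_irreducible : Prop :=
  forall Y : {vspace X},
    (forall a : 'End(X), a \in (N : {vspace 'End(X)}) -> (a @: Y <= Y)%VS) ->
    Y = 0%VS \/ Y = fullv.

(* An alias of the product type, so that this bracket does not compete with
   that of the direct sum. *)
Definition semidirect : Type := (lieSubalg_of N * X)%type.

HB.instance Definition _ := Vector.copy semidirect (lieSubalg_of N * X)%type.

Implicit Types u v w : semidirect.

Definition semidirect_bracket u v : semidirect :=
  ([lie u.1, v.1], (vsval u.1) v.2 - (vsval v.1) u.2).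

Lemma semidirect_linearl v : linear (fun u => semidirect_bracket u v).
Proof.
move=> k u w; congr pair; first exact: bracket_linearl.
rewrite /= lfunE /= lfunE /= linearD linearZ_LR /= scalerBr opprD.
by rewrite addrACA.
Qed.

Lemma semidirect_linearr u : linear (semidirect_bracket u).
Proof.
move=> k v w; congr pair; first exact: bracket_linearr.
rewrite /= lfunE /= lfunE /= linearD linearZ_LR /= scalerBr opprD.
by rewrite addrACA.
Qed.

Lemma semidirect_xx u : semidirect_bracket u u = 0.
Proof. by congr pair; [exact: bracketxx | exact: subrr]. Qed.

Lemma semidirect_jacobi u v w :
  semidirect_bracket u (semidirect_bracket v w)
    + semidirect_bracket v (semidirect_bracket w u)
    + semidirect_bracket w (semidirect_bracket u v) = 0.
Proof.
congr pair; first exact: jacobi.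
case: u v w => [a x] [b y] [c z] /=.
rewrite !linearB /= /commutator !add_lfunE !opp_lfunE !comp_lfunE.
exact: jacobi_cancel.
Qed.

HB.instance Definition _ := Vector_isLieAlgebra.Build F semidirect
  semidirect_linearl semidirect_linearr semidirect_xx semidirect_jacobi.

End Semidirect.

Definition in_class_I (F : fieldType) (L : lieAlgType F) : Prop :=
  exists N : lieAlgType F,
    is_simple N /\ lie_isomorphic L (N * N)%type.

Definition in_class_II (F : fieldType) (L : lieAlgType F) : Prop :=
  exists (X : vectType F) (N : operatorLieAlg X),
    is_irreducible N /\ lie_isomorphic L (semidirect N).

(* Main.v *)
From HB Require Import structures.
Require Import Defs.
From mathcomp Require Import all_boot all_order all_algebra.
From mathcomp Require Import boolp reals complex.

(** If [M] is a maximal subalgebra without non-zero ideals of [L], every non-zero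
    ideal [I] satisfies [M + I = L].  When [I] is commutative, [M] meets it
    trivially, acts on it faithfully and irreducibly, and [L] is the semidirect
    product of [M] and [I].  When [L] is semisimple and not simple,
    [L = I (+) J] for non-zero ideals, [M] is a complement of both, and hence the
    graph of an isomorphism between [I] and [J].

    The complement [J] is the orthogonal of [I] for the Killing form.  To see that
    an ideal [S] on which this form vanishes is zero, take [x] in [[S, S]] and let
    [D] act as [conj a] on the generalized eigenspace of [ad x] at [a].  Then [D]
    is a derivation and a polynomial in [ad x], so
    [\sum |a|^2 = tr (ad x \o D) = 0] and [ad x] is nilpotent; Engel's theorem
    gives a non-zero commutative ideal inside [[S, S]], unless [[S, S] = 0] and [S]
    itself is commutative. *)

Set Implicit Arguments.
Unset Strict Implicit.
Unset Printing Implicit Defensive.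

Import Order.TTheory GRing.Theory Num.Theory.
Local Open Scope ring_scope.

(** * Chinese remaindering modulo powers of linear factors *)

Section Polynomials.
Variable F : fieldType.
Implicit Types (r s : seq F) (m : F -> nat).

Lemma coprimep_XsubC_exp_prod r m x : x \notin r ->
  coprimep (('X - x%:P) ^+ m x) (\prod_(y <- r) ('X - y%:P) ^+ m y).
Proof.
move=> xr; rewrite coprimep_expl // big_seq.
elim/big_ind: _ => [|p q|y yr]; first exact: coprimep1.
  by move=> cp cq; rewrite coprimepMr cp.
rewrite coprimep_expr // coprimep_XsubC root_XsubC.
by apply: contraNneq xr => <-.
Qed.

Lemma poly_crt r m (c : F -> F) : uniq r ->
  exists p : {poly F}, forall x, x \in r -> ('X - x%:P) ^+ m x %| p - (c x)%:P.
Proof.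
elim: r => [|x r IHr] /= => [_|/andP[xr ur]]; first by exists 0.
have [p pP] := IHr ur.
have /Bezout_eq1_coprimepP[[a b] /= ab1] := coprimep_XsubC_exp_prod m xr.
set f := ('X - x%:P) ^+ m x in ab1 *; set g := \prod_(y <- r) _ in ab1.
(* The correction factor [b * g] is 1 modulo [f] and 0 modulo every other factor. *)
exists (p + ((c x)%:P - p) * (b * g)) => y; rewrite in_cons.
have [-> _|ynx /= yr] := eqVneq y x.
  have -> : b * g = 1 - a * f by rewrite -ab1 addrAC subrr add0r.
  rewrite mulrBr mulr1 addrA addrCA subrr addr0 addrAC subrr add0r.
  by rewrite dvdpNr mulrA dvdp_mull.
rewrite addrAC dvdp_add ?pP // !dvdp_mull //.
by rewrite /g (big_rem y) //= dvdp_mulr.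
Qed.

(** A value outside [s] imposes no condition, its exponent being 0. The congruence is thus available
    at a sum of two eigenvalues, which may fail to be an eigenvalue. *)
Lemma poly_crt_prod s (c : F -> F) : exists p : {poly F},
  forall x, ('X - x%:P) ^+ count_mem x s %| p - (c x)%:P.
Proof.
have [p pP] := poly_crt (fun x => count_mem x s) c (undup_uniq s).
exists p => x; have [/pP //|] := boolP (x \in undup s).
by rewrite mem_undup => /count_memPn ->; rewrite expr0 dvd1p.
Qed.

Lemma prod_XsubC_factor s x : exists2 q : {poly F},
  \prod_(y <- s) ('X - y%:P) = ('X - x%:P) ^+ count_mem x s * q & ~~ root q x.
Proof.
elim: s => [|y s [q qE qx]]; first by exists 1; rewrite ?big_nil ?mulr1 ?root1.
rewrite big_cons qE /=; have [->|nyx] := eqVneq y x.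
  by exists q; rewrite // addSn add0n exprS mulrA.
exists (('X - y%:P) * q); first by rewrite add0n mulrCA.
by rewrite rootM root_XsubC eq_sym (negPf nyx).
Qed.

End Polynomials.

(** * Generalized eigenvectors and polynomials in a matrix *)

Section Eigenvectors.
Variables (F : fieldType) (n : nat) (A : 'M[F]_n.+1).
Implicit Types (u : 'rV[F]_n.+1) (p q : {poly F}).

Local Notation "u \h p" := (u *m horner_mx A p) (at level 40, left associativity).

Lemma row_hornerM u p q : u \h (p * q) = (u \h p) \h q.
Proof. by rewrite rmorphM /= mulmxA. Qed.

Lemma row_hornerD u p q : u \h (p + q) = u \h p + u \h q.
Proof. by rewrite rmorphD /= mulmxDr. Qed.

Lemma row_horner1 u : u \h 1 = u.
Proof. by rewrite rmorph1 mulmx1. Qed.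

Lemma row_horner_dvdp u p q : p %| q -> u \h p = 0 -> u \h q = 0.
Proof.
by move=> /dvdpP[k ->] up; rewrite mulrC row_hornerM up mul0mx.
Qed.

(** The generalized eigenspace decomposition as an induction principle: a Bezout relation between
    coprime factors splits a vector killed by their product into vectors each killed by one
    factor. *)
Lemma generalized_eigen_ind (Q : 'rV[F]_n.+1 -> Prop) :
    (forall u v, Q u -> Q v -> Q (u + v)) ->
    (forall x k u, u \h ('X - x%:P) ^+ k = 0 -> Q u) ->
  forall s u, u \h (\prod_(x <- s) ('X - x%:P)) = 0 -> Q u.
Proof.
move=> QD Qe s; rewrite -prodr_undup_exp_count.
elim: (undup s) (undup_uniq s) => [_ u|x r IHr /= /andP[xr ur] u].
  rewrite big_nil row_horner1 => ->; apply: (Qe 0 0%N); exact: mul0mx.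
rewrite big_cons => u0.
have /Bezout_eq1_coprimepP[[a b] /= ab1] :=
  coprimep_XsubC_exp_prod (fun x => count_mem x s) xr.
rewrite -[u]row_horner1 -ab1 row_hornerD; apply: QD.
  apply: (IHr ur); rewrite -row_hornerM; apply: row_horner_dvdp u0.
  by rewrite -mulrA dvdp_mull.
apply: (Qe x (count_mem x s)); rewrite -row_hornerM; apply: row_horner_dvdp u0.
by rewrite -mulrA dvdp_mull // mulrC.
Qed.

(** The exponent [k] is arbitrary, but the power of ['X - x%:P] of exponent [k] is coprime to the
    part of the product away from [x]. Bezout thus lowers the exponent to the multiplicity of [x] in
    [s], and modulo that power [p] is the constant [c]. *)
Lemma generalized_eigen_horner s p c x k u :
    u \h (\prod_(y <- s) ('X - y%:P)) = 0 ->
    ('X - x%:P) ^+ count_mem x s %| p - c%:P ->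
    u \h ('X - x%:P) ^+ k = 0 ->
  u \h p = c *: u.
Proof.
move=> us /dvdpP[q /(canRL (subrK _)) ->] uk.
rewrite row_hornerD horner_mx_C mul_mx_scalar.
suff u0 : u \h ('X - x%:P) ^+ count_mem x s = 0.
  by rewrite mulrC row_hornerM u0 mul0mx add0r.
have [h hE hx] := prod_XsubC_factor s x.
have /Bezout_eq1_coprimepP[[a b] /= ab1] : coprimep (('X - x%:P) ^+ k) h.
  by rewrite coprimep_expl // coprimep_sym coprimep_XsubC.
rewrite -[X in _ \h X]mul1r -ab1 mulrDl row_hornerD.
rewrite (row_horner_dvdp _ uk) ?(row_horner_dvdp _ us) ?addr0 //.
  by rewrite hE -mulrA dvdp_mull // mulrC.
by rewrite mulrAC dvdp_mull.
Qed.

End Eigenvectors.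

(** * Linear functions and derivations of a bilinear product *)

Section LinearFunctions.
Variables (F : fieldType) (U V : lmodType F) (f : U -> V).
Hypothesis f_lin : linear f.

Lemma linear_funD u v : f (u + v) = f u + f v.
Proof. by have := f_lin 1 u v; rewrite !scale1r. Qed.

Lemma linear_fun0 : f 0 = 0.
Proof. by apply: (addrI (f 0)); rewrite -linear_funD !addr0. Qed.

Lemma linear_funZ a u : f (a *: u) = a *: f u.
Proof. by have := f_lin a u 0; rewrite linear_fun0 !addr0. Qed.

Lemma linear_funN u : f (- u) = - f u.
Proof. by rewrite -scaleN1r linear_funZ scaleN1r. Qed.

Lemma linear_funB u v : f (u - v) = f u - f v.
Proof. by rewrite linear_funD linear_funN. Qed.

End LinearFunctions.

Section Derivations.
Variables (F : fieldType) (V : lmodType F) (b : V -> V -> V) (f : V -> V).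
Hypotheses (b_linl : forall v, linear (b^~ v)) (b_linr : forall u, linear (b u)).
Hypotheses (f_lin : linear f) (fb : forall u v, f (b u v) = b (f u) v + b u (f v)).

(** By the Leibniz rule [f - (x + y)] acts on a product as [f - x] on the left factor plus [f - y]
    on the right one. After [i + j] applications every term has at least [i] on the left or at least
    [j] on the right. *)
Lemma iter_derivation_eigen x y i j u v :
    iter i (fun w => f w - x *: w) u = 0 ->
    iter j (fun w => f w - y *: w) v = 0 ->
  iter (i + j) (fun w => f w - (x + y) *: w) (b u v) = 0.
Proof.
pose g z w := f w - z *: w.
have g_lin z : linear (g z).
  by move=> a w w'; rewrite /g f_lin scalerDr opprD addrACA scalerBr !scalerA mulrC.
have gb u' v' : g (x + y) (b u' v') = b (g x u') v' + b u' (g y v').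
  rewrite /g fb (linear_funB (b_linl v')) (linear_funB (b_linr u')).
  rewrite (linear_funZ (b_linl v')) (linear_funZ (b_linr u')).
  by rewrite scalerDl opprD addrACA.
have it0 z k : iter k (g z) 0 = 0.
  by elim: k => //= k ->; exact: linear_fun0.
have itD z k w w' : iter k (g z) (w + w') = iter k (g z) w + iter k (g z) w'.
  by elim: k => //= k ->; exact: linear_funD.
rewrite -/(g x) -/(g y) -/(g (x + y)).
elim: i j u v => [|i IHi] j u v.
  by move=> /= -> _; rewrite (linear_fun0 (b_linl v)) it0.
elim: j u v => [|j IHj] u v ui.
  by move=> /= ->; rewrite (linear_fun0 (b_linr u)); exact: (it0 _ _.+1).
move=> vj; rewrite addSn iterSr gb itD.
rewrite IHi ?add0r -1?iterSr //; rewrite addnS -addSn IHj -?iterSr //.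
Qed.

End Derivations.

(** * The conjugate part of a complex matrix *)

Section ConjugatePart.
Variables (C : numClosedFieldType).

Lemma horner_trigmx n (T : 'M[C]_n.+1) p : is_trig_mx T ->
  is_trig_mx (horner_mx T p) /\ forall i, horner_mx T p i i = p.[T i i].
Proof.
move=> Ttrig.
have trigM (X Y : 'M[C]_n.+1) : is_trig_mx X -> is_trig_mx Y ->
    is_trig_mx (X *m Y) /\ forall i, (X *m Y) i i = X i i * Y i i.
  move=> /is_trig_mxP Xt /is_trig_mxP Yt; split=> [|i].
    apply/is_trig_mxP => i j ij; rewrite mxE big1 // => k _.
    have [ik|ki] := ltnP i k; first by rewrite Xt // mul0r.
    by rewrite Yt ?mulr0 // (leq_ltn_trans ki).
  rewrite mxE (bigD1 i) //= big1 ?addr0 // => k ki.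
  have [ik|ki'] := ltnP i k; first by rewrite Xt // mul0r.
  by rewrite Yt ?mulr0 // ltn_neqAle ki' (val_eqE k i) ki.
elim/poly_ind: p => [|p c [IHt IHd]].
  by rewrite rmorph0; split=> [|i]; rewrite ?mx0_is_trig // horner0 mxE.
rewrite rmorphD rmorphM /= horner_mx_X horner_mx_C.
have [Mt Md] := trigM _ _ IHt Ttrig; split=> [|i].
  apply/is_trig_mxP => i j ij; rewrite mxE (is_trig_mxP Mt) // mxE.
  by rewrite -val_eqE ltn_eqF // add0r.
by rewrite mxE [in LHS]Md IHd mxE eqxx !hornerE.
Qed.

(* [B] acts as [conj x] on the generalized eigenspace of [A] at [x]. *)
Lemma conjugate_part n (A : 'M[C]_n) : exists B : 'M[C]_n,
  [/\ forall U : 'M_n, stablemx U A -> stablemx U B,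
      forall b : 'rV[C]_n -> 'rV_n -> 'rV_n,
        (forall v, linear (b^~ v)) -> (forall u, linear (b u)) ->
        (forall u v, b u v *m A = b (u *m A) v + b u (v *m A)) ->
        forall u v, b u v *m B = b (u *m B) v + b u (v *m B)
    & \tr (A *m B) = 0 -> exists k, forall u : 'rV_n,
        iter k (mulmx^~ A) u = 0].
Proof.
case: n => [|n] in A *.
  exists 0; split=> [U _|b _ _ _ u v|_]; first exact: stablemx0.
  - by apply/rowP => -[].
  - by exists 0%N => u; apply/rowP => -[].
(* [A] is conjugate to a triangular [T], whose diagonal lists the eigenvalues with multiplicity. *)
have [] := @cotrigonalization C n.+1 [:: A].
  by move=> ? ? /[!inE] /eqP -> /eqP ->.
move=> P /unitarymx_unit Pu /=; rewrite andbT => Ttrig.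
set T := conjmx P A in Ttrig.
have AE : A = conjmx (invmx P) T by rewrite conjmxK.
set s := [seq T i i | i <- index_enum 'I_n.+1].
have chiE : char_poly T = \prod_(x <- s) ('X - x%:P).
  by rewrite char_poly_trig // big_map.
have annT : horner_mx T (\prod_(x <- s) ('X - x%:P)) = 0.
  by rewrite -chiE Cayley_Hamilton.
have Pu' : invmx P \in unitmx by rewrite unitmx_inv.
have hornerA (p : {poly C}) : horner_mx A p = conjmx (invmx P) (horner_mx T p).
  by rewrite AE horner_mx_conj ?row_free_unit ?stablemx_unit.
have annA (u : 'rV_n.+1) : u *m horner_mx A (\prod_(x <- s) ('X - x%:P)) = 0.
  by rewrite hornerA annT /conjmx mulmx0 mul0mx mulmx0.
(* At each eigenvalue [x], [p] is the constant [x^*] modulo the power of ['X - x%:P] given by the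
   multiplicity, so [p] at [A] acts as required. *)
have [p pP] := poly_crt_prod s Num.conj.
exists (horner_mx A p); split=> [U|b bl br bA u v|tr0].
- exact: horner_mx_stable.
- have annE (x : C) (u' : 'rV_n.+1) : u' *m horner_mx A ('X - x%:P) = u' *m A - x *: u'.
    by rewrite rmorphB /= horner_mx_X horner_mx_C mulmxBr mul_mx_scalar.
  have iterE (x : C) k (u' : 'rV_n.+1) : u' *m horner_mx A (('X - x%:P) ^+ k) =
      iter k (fun w => w *m A - x *: w) u'.
    elim: k => [|k IHk]; first by rewrite expr0 row_horner1.
    by rewrite exprSr row_hornerM IHk annE.
  (* By bilinearity [u] and [v] may be taken generalized eigenvectors, at [x] and [y]. Then [b u v]
     is one at [x + y], and conjugation is additive. *)
  move: u (annA u); apply: generalized_eigen_ind => [u1 u2 IH1 IH2|x i u ui].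
    rewrite (linear_funD (bl v)) !mulmxDl !(linear_funD (bl _)) IH1 IH2.
    by rewrite addrACA.
  move: v (annA v); apply: generalized_eigen_ind => [v1 v2 IH1 IH2|y j v vj].
    rewrite (linear_funD (br u)) !mulmxDl !(linear_funD (br _)) IH1 IH2.
    by rewrite addrACA.
  rewrite (generalized_eigen_horner (annA u) (pP x) ui).
  rewrite (generalized_eigen_horner (annA v) (pP y) vj).
  have uvij : b u v *m horner_mx A (('X - (x + y)%:P) ^+ (i + j)) = 0.
    rewrite iterE; apply: iter_derivation_eigen => //; rewrite -?iterE //.
    by move=> a w w'; rewrite mulmxDl scalemxAl.
  rewrite (generalized_eigen_horner (annA _) (pP _) uvij) rmorphD /=.
  by rewrite scalerDl (linear_funZ (bl v)) (linear_funZ (br u)).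
have Tii i : T i i = 0.
  have tr_horner q : \tr (horner_mx A q) = \sum_i q.[T i i].
    rewrite hornerA conjumx // invmxK mxtrace_mulC mulmxA mulmxV // mul1mx.
    by apply: eq_bigr => k _; rewrite (horner_trigmx q Ttrig).2.
  have pT k : p.[T k k] = (T k k)^*.
    apply/eqP; rewrite -subr_eq0 -[X in _ - X](hornerC _ (T k k)).
    rewrite -hornerN -hornerD -rootE -dvdp_XsubCl.
    apply: dvdp_trans (pP _); rewrite -[X in X %| _]expr1 dvdp_exp2l //.
    by rewrite -has_count has_pred1; apply/mapP; exists k; rewrite ?mem_index_enum.
  (* [A *m B] is the value of ['X * p] at [A], so its trace is the sum of the squared moduli of the
     eigenvalues. *)
  have sum0 : \sum_k `|T k k| ^+ 2 = 0.
    rewrite -[RHS]tr0 -{1}[A]horner_mx_X -[_ *m _]rmorphM tr_horner.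
    by apply: eq_bigr => k _; rewrite hornerM hornerX normCK pT.
  move: sum0 => /eqP; rewrite psumr_eq0 => [/allP sum0|k _]; last exact: exprn_ge0.
  by have /eqP/eqP := sum0 i (mem_index_enum i); rewrite expf_eq0 normr_eq0 => /eqP.
(* All eigenvalues vanish, so the characteristic polynomial is ['X ^+ n.+1] and Cayley-Hamilton
   gives this exponent. *)
exists n.+1 => u.
have iterE k : iter k (mulmx^~ A) u = u *m horner_mx A ('X ^+ k).
  elim: k => [|k IHk]; first by rewrite expr0 row_horner1.
  by rewrite exprSr row_hornerM horner_mx_X -IHk.
rewrite iterE -[RHS](annA u); congr (_ *m horner_mx A _).
rewrite (eq_big_seq (fun _ => 'X)) => [|_ /mapP[i _ ->]].
  rewrite big_const_seq count_predT size_map /index_enum -enumT size_enum_ord.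
  by rewrite -Monoid.iteropE.
by rewrite Tii subr0.
Qed.
End ConjugatePart.

(** * Subspaces given by propositions *)

Lemma exists_maximal_vspace (F : fieldType) (V : vectType F)
    (P : {vspace V} -> Prop) U0 : P U0 ->
  exists U, P U /\ forall W, P W -> (U <= W)%VS -> W = U.
Proof.
have [n] := ubnP (\dim {:V} - \dim U0); elim: n U0 => // n IHn U0 ltn PU0.
have [[W [PW UW WU]]|noW] := EM (exists W, [/\ P W, (U0 <= W)%VS & W != U0]).
  apply: (IHn W) => //; rewrite -ltnS; apply: leq_trans ltn; rewrite ltnS.
  have lt0W : (\dim U0 < \dim W)%N by rewrite (ltn_leqif (dimv_leqif_eq UW)) eq_sym.
  by rewrite ltn_sub2l // (leq_trans lt0W) // dimvS ?subvf.
exists U0; split=> // W PW UW; apply/eqP/negPn/negP => WU.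
by apply: noW; exists W.
Qed.

(** A maximal subspace inside [P] exhausts [P], since adjoining the line of a vector satisfying [P]
    stays inside [P]. *)
Lemma vspace_comprehension (F : fieldType) (V : vectType F) (P : V -> Prop) :
    P 0 -> (forall a x y, P x -> P y -> P (a *: x + y)) ->
  exists U : {vspace V}, forall x, x \in U <-> P x.
Proof.
move=> P0 PD.
have [|U [PU Umax]] := @exists_maximal_vspace _ _
    (fun U : {vspace V} => forall x, x \in U -> P x) 0%VS.
  by move=> x; rewrite memv0 => /eqP ->.
exists U => x; split=> [/PU //|Px].
suff <- : (U + <[x]>)%VS = U by rewrite (subvP (addvSr _ _)) ?memv_line.
apply: Umax; last exact: addvSl.
move=> _ /memv_addP[u uU [_ /vlineP[a ->] ->]].
by rewrite addrC; apply: PD => //; apply: PU.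
Qed.

(** * Brackets, ideals and Engel's theorem *)

Section LieBasics.
Variables (F : fieldType) (L : lieAlgType F).
Implicit Types (x y z : L) (U V W K S : {vspace L}).

HB.instance Definition _ x :=
  GRing.isLinear.Build F L L _ (bracket x) (bracket_linearr x).

Lemma lieDl x y z : [lie x + y, z] = [lie x, z] + [lie y, z].
Proof. exact: (linear_funD (bracket_linearl z)). Qed.
Lemma lieZl a x z : [lie a *: x, z] = a *: [lie x, z].
Proof. exact: (linear_funZ (bracket_linearl z)). Qed.
Lemma lie0x z : [lie 0, z] = 0.
Proof. exact: (linear_fun0 (bracket_linearl z)). Qed.
Lemma lieDr x y z : [lie z, x + y] = [lie z, x] + [lie z, y].
Proof. exact: linearD. Qed.
Lemma lieZr a x z : [lie z, a *: x] = a *: [lie z, x].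
Proof. exact: linearZ. Qed.
Lemma liex0 z : [lie z, 0] = 0.
Proof. exact: linear0. Qed.
Lemma lieNr x z : [lie z, - x] = - [lie z, x].
Proof. exact: linearN. Qed.

Lemma lieC x y : [lie x, y] = - [lie y, x].
Proof.
apply/eqP; rewrite -addr_eq0; apply/eqP.
have := bracketxx (x + y).
by rewrite lieDl !lieDr !bracketxx addr0 add0r.
Qed.

Lemma lie_leibniz x y z :
  [lie x, [lie y, z]] = [lie [lie x, y], z] + [lie y, [lie x, z]].
Proof.
have /eqP := jacobi x y z; rewrite -addrA addr_eq0 => /eqP ->.
by rewrite opprD addrC -lieC -lieNr -[- [lie z, x]]lieC.
Qed.

Lemma lie_comm_leibniz x y z :
  [lie [lie x, y], z] = [lie x, [lie y, z]] - [lie y, [lie x, z]].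
Proof. by rewrite (lie_leibniz x y z) addrK. Qed.

Lemma ideal_memr U x y : is_ideal U -> x \in U -> [lie x, y] \in U.
Proof. by move=> idU xU; rewrite lieC memvN idU. Qed.

Lemma ideal_subalgebra U : is_ideal U -> is_subalgebra U.
Proof. by move=> idU x y _ yU; apply: idU. Qed.

Lemma ideal_cap U V : is_ideal U -> is_ideal V -> is_ideal (U :&: V)%VS.
Proof.
move=> idU idV x y /memv_capP[yU yV].
by apply/memv_capP; split; [apply: idU|apply: idV].
Qed.

Lemma ideal_lie_disjoint U V x y : is_ideal U -> is_ideal V -> (U :&: V = 0)%VS ->
  x \in U -> y \in V -> [lie x, y] = 0.
Proof.
move=> idU idV UV0 xU yV; apply/eqP; rewrite -memv0 -UV0.
by apply/memv_capP; split; [apply: ideal_memr|apply: idV].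
Qed.

Lemma subalgebra_add_ideal U V :
  is_subalgebra U -> is_ideal V -> is_subalgebra (U + V)%VS.
Proof.
move=> sU idV _ _ /memv_addP[u uU [v vV ->]] /memv_addP[u' u'U [v' v'V ->]].
rewrite lieDl lieDr -addrA; apply: memv_add; first exact: sU.
by rewrite memvD ?(idV _ v') // (ideal_memr _ idV).
Qed.

Definition lie_span U V : {vspace L} :=
  <<[seq [lie x, y] | x <- vbasis U, y <- vbasis V]>>%VS.

Lemma lie_span_ind U V (P : L -> Prop) :
    P 0 -> (forall x y, P x -> P y -> P (x + y)) -> (forall a x, P x -> P (a *: x)) ->
    (forall x y, x \in U -> y \in V -> P [lie x, y]) ->
  forall z, z \in lie_span U V -> P z.
Proof.
move=> P0 PD PZ Pl z; rewrite /lie_span; set X := [seq _ | _ <- _, _ <- _] => zX.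
rewrite (coord_span (X := in_tuple X) zX); elim/big_ind: _ => // i _; apply: PZ.
have /allpairsP[[x y] /= [xU yV ->]] : (in_tuple X)`_i \in X by exact: mem_nth.
by apply: Pl; exact: vbasis_mem.
Qed.

Lemma memv_lie_span U V x y : x \in U -> y \in V -> [lie x, y] \in lie_span U V.
Proof.
move=> xU yV; rewrite (coord_vbasis yV) linear_sum memv_suml // => j _.
rewrite linearZ memvZ //= lieC memvN (coord_vbasis xU) linear_sum memv_suml // => i _.
rewrite linearZ memvZ //= lieC memvN memv_span //.
by apply/allpairsP; exists ((vbasis U)`_i, (vbasis V)`_j); rewrite /= !mem_nth ?size_tuple.
Qed.

Lemma ideal_lie_span U V : is_ideal U -> is_ideal V -> is_ideal (lie_span U V).
Proof.
move=> idU idV x; apply: lie_span_ind => [|y z yP zP|a y yP|y z yU zV].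
- by rewrite liex0 mem0v.
- by rewrite lieDr memvD.
- by rewrite lieZr memvZ.
- by rewrite lie_leibniz memvD // memv_lie_span //; [apply: idU|apply: idV].
Qed.

(* Engel's theorem for [K] acting on the quotient [V / W]. *)
Lemma engel K : is_subalgebra K ->
    (forall x y, x \in K -> exists k, iter k (bracket x) y = 0) ->
  forall V W, ~~ (V <= W)%VS ->
    (forall x y, x \in K -> y \in V -> [lie x, y] \in V) ->
    (forall x y, x \in K -> y \in W -> [lie x, y] \in W) ->
  exists v, [/\ v \in V, v \notin W & forall x, x \in K -> [lie x, v] \in W].
Proof.
have [n] := ubnP (\dim K); elim: n K => // n IHn K ltK sK nilK V W VW KV KW.
have [K0|K0] := eqVneq K 0%VS.
  have [v vV vW] := subvPn VW; exists v; split=> // x.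
  by rewrite K0 memv0 => /eqP ->; rewrite lie0x mem0v.
have [|H [[sH HK HnK] Hmax]] := @exists_maximal_vspace _ _
    (fun H => [/\ is_subalgebra H, (H <= K)%VS & H != K]) 0%VS.
  split; rewrite ?sub0v 1?eq_sym // => x y; rewrite !memv0 => /eqP -> _.
  by rewrite lie0x.
have ltHK : (\dim H < \dim K)%N by rewrite (ltn_leqif (dimv_leqif_eq HK)).
have subHK x : x \in H -> x \in K by move/(subvP HK).
have engelH := IHn H (leq_trans ltHK ltK) sH (fun x y xH => nilK x y (subHK x xH)).
(* The induction hypothesis for [H] acting on [K / H] gives [z] outside [H] that normalizes [H];
   maximality of [H] then forces [K = H + <[z]>]. *)
have [||| z [zK zH Hz]] := engelH K H.
- by apply: contra HnK => KH; rewrite eqEsubv HK.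
- by move=> x y /subHK; apply: sK.
- exact: sH.
have KE : K = (H + <[z]>)%VS.
  apply/eqP/negPn/negP => neqK; move/negP: zH; apply.
  suff -> : H = (H + <[z]>)%VS by rewrite (subvP (addvSr _ _)) ?memv_line.
  apply/esym/Hmax; last exact: addvSl.
  split; [|by rewrite subv_add HK|by rewrite eq_sym].
  move=> _ _ /memv_addP[h hH [_ /vlineP[a ->] ->]]
    /memv_addP[h' h'H [_ /vlineP[a' ->] ->]].
  apply: (subvP (addvSl _ _)).
  rewrite lieDl !lieDr !(lieZl, lieZr) bracketxx !scaler0 addr0.
  by rewrite [ [lie z, h'] ]lieC !memvD ?sH ?memvZ ?memvN ?Hz.
(* The same hypothesis on [V / W] gives [v] killed by [H] modulo [W]; applying [z] preserves this
   because [z] normalizes [H]. *)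
have [|| v [vV vW Hv]] := engelH V W VW.
- by move=> x y /subHK; apply: KV.
- by move=> x y /subHK; apply: KW.
have good k : let w := iter k (bracket z) v in
    w \in V /\ forall x, x \in H -> [lie x, w] \in W.
  elim: k => //= k [wV Hw]; split=> [|x xH]; first exact: KV.
  by rewrite lie_leibniz memvD ?Hw ?Hz // KW // Hw.
have exk : exists k, iter k (bracket z) v \in W.
  by have [k kP] := nilK z v zK; exists k; rewrite kP mem0v.
(* The last iterate outside [W] is killed modulo [W] by [z] as well as by [H]. *)
have [[|k] kW kmin] := ex_minnP exk; first by rewrite kW in vW.
have [wV Hw] := good k; exists (iter k (bracket z) v); split=> // [|x].
  by apply/negP => /kmin; rewrite ltnn.
rewrite KE => /memv_addP[h hH [_ /vlineP[a ->] ->]].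
by rewrite lieDl lieZl memvD ?Hw ?memvZ //; exact: kW.
Qed.

(* The centre of [S], non-zero by Engel's theorem, is a commutative ideal of [L]. *)
Lemma semisimple_nil_ideal S : is_semisimple L -> is_ideal S ->
    (forall x y, x \in S -> exists k, iter k (bracket x) y = 0) -> S = 0%VS.
Proof.
move=> ssL idS nilS; apply/eqP/negPn/negP => S0.
have [|||v [vS v0 Sv]] := engel (ideal_subalgebra idS) nilS (V := S) (W := 0%VS).
- by rewrite subv0.
- by move=> x y _; apply: idS.
- by move=> x y _; rewrite memv0 => /eqP ->; rewrite liex0 mem0v.
have [||Z ZP] := @vspace_comprehension _ _
    (fun y => y \in S /\ forall x, x \in S -> [lie x, y] = 0).
- by split=> [|x _]; rewrite ?mem0v ?liex0.
- move=> a x y [xS xP] [yS yP]; split=> [|z zS]; first by rewrite memvD ?memvZ.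
  by rewrite lieDr lieZr xP ?yP // scaler0 addr0.
have idZ : is_ideal Z.
  move=> x y /ZP[yS yP]; apply/ZP; split=> [|z zS]; first exact: idS.
  by rewrite lie_leibniz (yP z zS) liex0 addr0 yP // ideal_memr.
have Z0 : Z = 0%VS by apply: ssL => // x y /ZP[xS _] /ZP[_]; apply.
have : v \in Z by apply/ZP; split=> // x /Sv; rewrite memv0 => /eqP.
by rewrite Z0; apply/negP.
Qed.

End LieBasics.

(** * The Killing form and complements of ideals *)

Import VectorInternalTheory.

Lemma mem_r2v (K : fieldType) (V : vectType K) (u : 'rV[K]_(dim V)) (U : {vspace V}) :
  (r2v u \in U) = (u <= vs2mx U)%MS.
Proof. by rewrite -[u in RHS]r2vK -genmxE. Qed.

Section KillingForm.
Variables (C : numClosedFieldType) (L : lieAlgType C).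
Implicit Types (x y z : L) (U V I S : {vspace L}).

Definition ad_mx x : 'M[C]_(dim L) := lin1_mx (v2r \o bracket x \o r2v).

Lemma mul_ad_mx x u : u *m ad_mx x = v2r [lie x, r2v u].
Proof. exact: (mul_rV_lin1 (v2r \o bracket x \o r2v)). Qed.

Lemma ad_mx_linear : linear ad_mx.
Proof.
move=> a x y; apply/row_matrixP => i; rewrite !rowE mulmxDr -scalemxAr !mul_ad_mx.
by rewrite lieDl lieZl linearD linearZ.
Qed.
HB.instance Definition _ := GRing.isLinear.Build C L 'M[C]_(dim L) _ ad_mx ad_mx_linear.

(** Matrices act on row vectors from the right, which reverses the order of composition. *)
Lemma ad_mx_lie x y : ad_mx [lie x, y] = ad_mx y *m ad_mx x - ad_mx x *m ad_mx y.
Proof.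
apply/row_matrixP => i; rewrite !rowE mulmxBr !mulmxA !mul_ad_mx !v2rK.
by rewrite -linearB -lie_comm_leibniz.
Qed.

Definition killing x y := \tr (ad_mx x *m ad_mx y).

Lemma killing_lie x y z : killing [lie x, y] z = killing x [lie y, z].
Proof.
rewrite /killing !ad_mx_lie mulmxBl mulmxBr !linearB /= !mulmxA; congr (_ - _).
by rewrite -[in LHS]mulmxA mxtrace_mulC.
Qed.

(** The core of Cartan's criterion. No element inducing [B] is sought: as [B] is a derivation, its
    commutator with an adjoint matrix is again adjoint, which reduces the trace to values of the
    Killing form. *)
Lemma killing0_nil S : is_ideal S ->
    (forall x y, x \in S -> y \in S -> killing x y = 0) ->
  forall x y, x \in lie_span S S -> exists k, iter k (bracket x) y = 0.
Proof.
move=> idS kS x y xSS.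
have [B [Bstab Bder Bnil]] := conjugate_part (ad_mx x).
have BS b : b \in S -> r2v (v2r b *m B) \in S.
  move=> bS; rewrite mem_r2v; apply: submx_trans (Bstab (vs2mx S) _).
    by rewrite submxMr // -mem_r2v v2rK.
  apply/row_subP => i; rewrite row_mul mul_ad_mx -mem_r2v v2rK idS //.
  by rewrite mem_r2v row_sub.
have Blie b : ad_mx (r2v (v2r b *m B)) = ad_mx b *m B - B *m ad_mx b.
  apply/row_matrixP => i; rewrite !rowE mulmxBr !mulmxA !mul_ad_mx.
  set w := delta_mx 0 i; pose br (u v : 'rV[C]_(dim L)) := v2r [lie r2v u, r2v v].
  have := Bder br _ _ _ (v2r b) w; rewrite /br v2rK => -> //.
  - by rewrite addrK.
  - by move=> v a u u'; rewrite linearP lieDl lieZl linearP.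
  - by move=> u a v v'; rewrite linearP lieDr lieZr linearP.
  - by move=> u v; rewrite !mul_ad_mx !v2rK lie_leibniz linearD.
have [k kP] : exists k, forall u : 'rV_(dim L), iter k (mulmx^~ (ad_mx x)) u = 0.
  (* [B] stays fixed while [x] varies, so the trace condition is linear in [x] and need only be
     checked on brackets. *)
  apply: Bnil; clear Bder Bstab; move: x xSS.
  apply: lie_span_ind => [|x1 x2 e1 e2|a x1 e1|a b aS bS].
  - by rewrite linear0 mul0mx mxtrace0.
  - by rewrite linearD mulmxDl mxtraceD e1 e2 addr0.
  - by rewrite linearZ -scalemxAl mxtraceZ e1 mulr0.
  have -> : ad_mx [lie a, b] *m B = ad_mx b *m (ad_mx a *m B) - ad_mx a *m ad_mx b *m B.
    by rewrite ad_mx_lie mulmxBl !mulmxA.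
  (* Cyclicity gives the trace of [ad_mx a] times a commutator of [B] and [ad_mx b]: minus the
     Killing form of [a] and the image of [b] under [B]. *)
  rewrite linearB /= mxtrace_mulC -linearB -!mulmxA -mulmxBr -opprB -Blie mulmxN.
  by rewrite linearN /= [X in - X](kS a) ?oppr0 // BS.
exists k; apply: v2r_inj; rewrite linear0 -[RHS](kP (v2r y)).
elim: {kP} k => //= k <-; by rewrite mul_ad_mx v2rK.
Qed.

Lemma semisimple_killing0 S : is_semisimple L -> is_ideal S ->
  (forall x y, x \in S -> y \in S -> killing x y = 0) -> S = 0%VS.
Proof.
move=> ssL idS kS; apply: (ssL _ idS) => x y xS yS; apply/eqP.
rewrite -memv0 -(semisimple_nil_ideal ssL (ideal_lie_span idS idS)).
  exact: memv_lie_span.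
by move=> u v; apply: killing0_nil.
Qed.

Lemma semisimple_ideal_compl I : is_semisimple L -> is_ideal I ->
  exists J, [/\ is_ideal J, (I :&: J = 0)%VS & (I + J = fullv)%VS].
Proof.
move=> ssL idI.
(* The kernel of [phi] is the orthogonal of [I], of codimension at most [\dim I]. *)
pose phi : L -> 'rV[C]_(\dim I) :=
  fun x => \row_i killing x (vbasis I)`_i.
have phi_lin : linear phi.
  move=> a x y; apply/rowP => i.
  by rewrite !mxE /killing linearP mulmxDl -scalemxAl linearP.
pose f : 'Hom(L, 'rV[C]_(\dim I)) := linfun (HB.pack phi
  (GRing.isLinear.Build C L _ _ phi phi_lin) : {linear L -> _}).
have kerP x : reflect (forall y, y \in I -> killing x y = 0) (x \in lker f).
  rewrite memv_ker lfunE /=; apply: (iffP eqP) => [/rowP x0 y yI|x0].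
    rewrite (coord_vbasis yI) /killing linear_sum mulmx_sumr linear_sum big1 // => i _.
    have := x0 i; rewrite !mxE => e.
    by rewrite linearZ -scalemxAr linearZ /= [X in _ * X]e mulr0.
  by apply/rowP => i; rewrite !mxE x0 // vbasis_mem // mem_nth ?size_tuple.
have idJ : is_ideal (lker f).
  move=> x y /kerP yI; apply/kerP => z zI.
  rewrite lieC /killing linearN mulNmx linearN /= -/(killing _ _).
  by rewrite killing_lie yI ?oppr0 // idI.
have IJ0 : (I :&: lker f = 0)%VS.
  apply: semisimple_killing0 => //; first exact: ideal_cap.
  by move=> x y /memv_capP[_ /kerP xI] /memv_capP[yI _]; apply: xI.
exists (lker f); split=> //; apply/eqP; rewrite eqEdim subvf /=.
rewrite dimv_disjoint_sum // -[X in (X <= _)%N](limg_ker_dim f fullv).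
rewrite capfv addnC leq_add2r.
by rewrite (leq_trans (dimvS (subvf _))) // dimvf /dim /= mul1n.
Qed.

End KillingForm.

Lemma injective_linear_bijective (F : fieldType) (U V : vectType F)
    (f : {linear U -> V}) :
  injective f -> \dim {:U} = \dim {:V} -> bijective f.
Proof.
move=> f_inj dimUV.
have ker0 : lker (linfun f) == 0%VS by apply/lker0P => x y; rewrite !lfunE; exact: f_inj.
have imf : limg (linfun f) = fullv.
  apply/eqP; rewrite eqEdim subvf -dimUV limg_dim_eq ?leqnn //.
  by rewrite (eqP ker0) capv0.
exists (linfun f)^-1%VF => x; first by rewrite -(lfunE f x) lker0_lfunK.
by rewrite -(lfunE f) limg_lfunVK // imf memvf.
Qed.

(** * Maximal subalgebras without non-zero ideals *)

Section CoreFreeMaximal.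
Variables (F : fieldType) (L : lieAlgType F) (M : {vspace L}).
Hypothesis maxM : is_maximal_subalgebra M.
Hypothesis coreM : forall U, is_ideal U -> (U <= M)%VS -> U = 0%VS.
Implicit Types (I U V : {vspace L}).

Lemma core_free_sup I : is_ideal I -> I <> 0%VS -> (M + I = fullv)%VS.
Proof.
move=> idI I0; have [sM _ Mmax] := maxM.
have [MI|//] := Mmax _ (subalgebra_add_ideal sM idI) (addvSl _ _).
by case: I0; apply: coreM => //; rewrite -MI addvSr.
Qed.

(** In [L = M + V], [M] preserves [M :&: U] and [V] annihilates [U], so the intersection is an ideal
    inside [M]. This serves for two commuting ideals and, with [U = V], for a commutative one. *)
Lemma core_free_cap U V : is_ideal U -> is_ideal V ->
    (forall x y, x \in V -> y \in U -> [lie x, y] = 0) -> V <> 0%VS ->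
  (M :&: U = 0)%VS.
Proof.
move=> idU idV UV V0; have [sM _ _] := maxM; apply: coreM (capvSl _ _) => x y.
have: x \in (M + V)%VS by rewrite core_free_sup ?memvf.
move=> /memv_addP[m mM [v vV ->]] /memv_capP[yM yU].
by rewrite lieDl (UV v) // addr0; apply/memv_capP; split; [apply: sM|apply: idU].
Qed.

(** Modular law: as [L = M + U], an element of [I] differs from one of [U] by an element of
    [M :&: I]. *)
Lemma core_free_minimal I U : (M :&: I = 0)%VS -> is_ideal U -> (U <= I)%VS ->
  U = 0%VS \/ U = I.
Proof.
move=> MI0 idU UI; have [U0|/eqP U0] := eqVneq U 0%VS; [by left|right].
apply/eqP; rewrite eqEsubv UI; apply/subvP => i iI.
have: i \in (M + U)%VS by rewrite core_free_sup ?memvf.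
move=> /memv_addP[m mM [u uU iE]].
suff: m \in (M :&: I)%VS by rewrite MI0 memv0 iE => /eqP ->; rewrite add0r.
have uI := subvP UI u uU.
by apply/memv_capP; split=> //; rewrite -(addrK u m) -iE memvB.
Qed.

End CoreFreeMaximal.

(** * Projections, and subspaces of a subspace *)

Section Projections.
Variables (F : fieldType) (V : vectType F) (U W : {vspace V}).
Hypothesis UW0 : (U :&: W = 0)%VS.

Lemma daddv_pi_unique u w : u \in U -> w \in W -> daddv_pi U W (u + w) = u.
Proof.
move=> uU wW; have piD (f : 'End(V)) : f (u + w) = f u + f w by exact: linearD.
rewrite piD daddv_pi_id //.
have WU0 : (W :&: U = 0)%VS by rewrite capvC.
have := daddv_pi_add UW0 (subvP (addvSr U W) _ wW).
rewrite (daddv_pi_id WU0 wW) => /(canRL (addrK _)).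
by rewrite subrr => ->; rewrite addr0.
Qed.

End Projections.

Section SubspaceLift.
Variables (F : fieldType) (V : vectType F) (A : {vspace V}).
Implicit Types Y : {vspace subvs_of A}.

Definition subvs_lift Y : {vspace V} :=
  (linfun (vsval : {linear subvs_of A -> V}) @: Y)%VS.

Lemma subvs_liftP Y x : reflect (exists2 y, y \in Y & x = vsval y) (x \in subvs_lift Y).
Proof.
by apply: (iffP memv_imgP) => -[y yY ->]; exists y; rewrite // lfunE.
Qed.

Lemma subvs_lift_sub Y : (subvs_lift Y <= A)%VS.
Proof. by apply/subvP => _ /subvs_liftP[y _ ->]; apply: subvsP. Qed.

Lemma subvs_lift_eq0 Y : subvs_lift Y = 0%VS -> Y = 0%VS.
Proof.
move=> Y0; apply/eqP; rewrite -subv0; apply/subvP => y yY.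
rewrite memv0 -(inj_eq val_inj) -memv0 -Y0; apply/subvs_liftP.
by exists y.
Qed.

Lemma subvs_lift_full Y : subvs_lift Y = A -> Y = fullv.
Proof.
move=> YA; apply/eqP; rewrite eqEsubv subvf; apply/subvP => y _.
have: vsval y \in subvs_lift Y by rewrite YA subvsP.
by move=> /subvs_liftP[y' y'Y /val_inj ->].
Qed.

End SubspaceLift.

(** * Two complementary ideals: class I *)

Section ClassI.
Variables (C : numClosedFieldType) (L : lieAlgType C) (M : {vspace L}).
Hypothesis maxM : is_maximal_subalgebra M.
Hypothesis coreM : forall U, is_ideal U -> (U <= M)%VS -> U = 0%VS.

(** Ideals of [I] are ideals of [L] because [J] centralizes [I], so minimality of [I] leaves only
    the trivial ones. The map to [N * N] pairs the projection to [I] with the projection to [J]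
    carried back to [I] along [M]. *)
Lemma core_free_class_I (I J : {vspace L}) : is_semisimple L ->
    is_ideal I -> is_ideal J -> I <> 0%VS -> J <> 0%VS ->
    (I :&: J = 0)%VS -> (I + J = fullv)%VS ->
  in_class_I L.
Proof.
move=> ssL idI idJ I0 J0 IJ0 IJ; have [sM _ _] := maxM.
have JI0 : (J :&: I = 0)%VS by rewrite capvC.
have lieIJ x y : x \in I -> y \in J -> [lie x, y] = 0.
  exact: ideal_lie_disjoint.
have lieJI x y : x \in J -> y \in I -> [lie x, y] = 0.
  exact: ideal_lie_disjoint.
have MI0 : (M :&: I = 0)%VS by apply: (core_free_cap maxM coreM idI idJ).
have MJ0 : (M :&: J = 0)%VS by apply: (core_free_cap maxM coreM idJ idI).
have MI := core_free_sup maxM coreM idI I0.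
have MJ := core_free_sup maxM coreM idJ J0.
have IM0 : (I :&: M = 0)%VS by rewrite capvC.
pose sI := LieSubalg (ideal_subalgebra idI).
pose N : lieAlgType C := lieSubalg_of sI.
pose p := daddv_pi I J; pose q := daddv_pi J I; pose r := daddv_pi I M.
have pqE x : x = p x + q x by rewrite daddv_pi_add // IJ memvf.
have pI x : p x \in I by exact: memv_pi.
have qJ x : q x \in J by exact: memv_pi.
have rI x : r x \in I by exact: memv_pi.
have pE i j : i \in I -> j \in J -> p (i + j) = i by exact: daddv_pi_unique.
have qE i j : i \in I -> j \in J -> q (i + j) = j.
  by rewrite addrC => iI jJ; apply: daddv_pi_unique.
(* [M] is the graph of an isomorphism [I -> J]; [b] is its inverse composed with
   the projection [q] onto [J]. *)
pose b x := - r (q x).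
have bI x : b x \in I by rewrite memvN.
have bM x : b x + q x \in M.
  have : q x \in (I + M)%VS by rewrite addvC MI memvf.
  by move=> /memv_addP[i iI [m mM qxE]]; rewrite /b qxE /r daddv_pi_unique // addKr.
have bE i x : i \in I -> i + q x \in M -> b x = i.
  move=> iI iM; apply/eqP; rewrite -subr_eq0 -memv0 -MI0.
  apply/memv_capP; split; last exact: memvB.
  by rewrite -[b x](addrK (q x)) -addrA -opprD [q x + i]addrC memvB.
have lieE x y : [lie x, y] = [lie p x, p y] + [lie q x, q y].
  rewrite {1}[x]pqE {1}[y]pqE lieDl !lieDr (lieIJ (p x) (q y)) //.
  by rewrite (lieJI (q x) (p y)) // addr0 add0r.
have p_lie x y : p [lie x, y] = [lie p x, p y].
  by rewrite lieE pE //; [exact: (idI)|exact: idJ].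
have q_lie x y : q [lie x, y] = [lie q x, q y].
  by rewrite lieE qE //; [exact: (idI)|exact: idJ].
have b_lie x y : b [lie x, y] = [lie b x, b y].
  apply: bE; first exact: (idI).
  rewrite q_lie.
  suff -> : [lie b x, b y] + [lie q x, q y] = [lie b x + q x, b y + q y] by exact: sM.
  by rewrite lieDl !lieDr (lieIJ (b x) (q y)) // (lieJI (q x) (b y)) // addr0 add0r.
pose f x : (N * N)%type := (vsproj I (p x), vsproj I (b x)).
have homP (g : 'End(L)) a x y : g (a *: x + y) = a *: g x + g y by exact: linearP.
have f_lin : linear f.
  move=> a x y; rewrite /f /b !homP opprD -scalerN.
  by rewrite (linearP (vsproj I) a (p x)) (linearP (vsproj I) a (- _)).
exists N; split.
  split=> [comN|U idU].
    apply: I0; apply: (ssL _ (idI)) => x y xI yI.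
    have := comN (vsproj I x) (vsproj I y) (memvf _) (memvf _).
    by move=> /(congr1 vsval); rewrite /= !vsprojK.
  have idU' : is_ideal (subvs_lift U).
    move=> x _ /subvs_liftP[u uU ->].
    have -> : [lie x, vsval u] = [lie p x, vsval u].
      by rewrite {1}[x]pqE lieDl (lieJI (q x)) ?subvsP // addr0.
    apply/subvs_liftP; exists [lie (vsproj I (p x) : N), (u : N)]; first exact: idU.
    by rewrite /= vsprojK.
  have [] := core_free_minimal maxM coreM MI0 idU' (subvs_lift_sub U).
    by move/subvs_lift_eq0; left.
  by move/subvs_lift_full; right.
pose fl : {linear L -> (N * N)%type} := HB.pack f (GRing.isLinear.Build C L _ _ f f_lin).
exists fl; split=> [|x y]; last first.
  by congr pair; apply: val_inj; rewrite /= !vsprojK ?p_lie ?b_lie //; exact: (idI).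
apply: injective_linear_bijective.
  (* A kernel vector has no component in [I], and its component in [J] lies in [M], which meets [J]
     trivially. *)
  apply: raddf_inj => x [/(congr1 vsval) /= px0 /(congr1 vsval) /= bx0].
  rewrite !vsprojK // in px0 bx0.
  have := bM x; rewrite bx0 add0r => qM.
  rewrite [x]pqE px0 add0r; apply/eqP; rewrite -memv0 -MJ0.
  exact/memv_capP.
have dimIJ : \dim {:L} = (\dim I + \dim J)%N by rewrite -IJ dimv_disjoint_sum.
have dimMI : \dim {:L} = (\dim M + \dim I)%N by rewrite -MI dimv_disjoint_sum.
have dimMJ : \dim {:L} = (\dim M + \dim J)%N by rewrite -MJ dimv_disjoint_sum.
have /eqP : \dim J = \dim I.
  by apply/eqP; rewrite -(eqn_add2l (\dim M)) -dimMJ dimMI.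
by rewrite dimIJ dimvf => /eqP ->.
Qed.

End ClassI.

(** * Commutative ideals: class II *)

Section IdealRepresentation.
Variables (F : fieldType) (L : lieAlgType F) (I : {vspace L}).
Hypothesis idI : is_ideal I.

Lemma ideal_act_linear x : linear (fun u : subvs_of I => vsproj I [lie x, vsval u]).
Proof. by move=> a u v; rewrite /= lieDr lieZr linearP. Qed.

Definition ideal_act x : 'End(subvs_of I) :=
  linfun (HB.pack (fun u : subvs_of I => vsproj I [lie x, vsval u])
    (GRing.isLinear.Build F _ _ _ _ (ideal_act_linear x)) : {linear _ -> _}).

Lemma val_ideal_act x u : vsval (ideal_act x u) = [lie x, vsval u].
Proof. by rewrite lfunE /= vsprojK // idI ?subvsP. Qed.

Lemma ideal_act_is_linear : linear ideal_act.
Proof.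
move=> a x y; apply/lfunP => u; apply: val_inj.
by rewrite add_lfunE scale_lfunE linearP /= !val_ideal_act lieDl lieZl.
Qed.
HB.instance Definition _ := GRing.isLinear.Build F L _ _ ideal_act ideal_act_is_linear.

Lemma ideal_act_lie x y : ideal_act [lie x, y] = [lie ideal_act x, ideal_act y].
Proof.
apply/lfunP => u; apply: val_inj.
rewrite /= /commutator add_lfunE opp_lfunE !comp_lfunE linearB /=.
by rewrite !val_ideal_act lie_comm_leibniz.
Qed.

End IdealRepresentation.

Section ClassII.
Variables (F : fieldType) (L : lieAlgType F) (M : {vspace L}).
Hypothesis maxM : is_maximal_subalgebra M.
Hypothesis coreM : forall U, is_ideal U -> (U <= M)%VS -> U = 0%VS.

(** The operator algebra is the image of [M] acting on [I]. Since [I] acts on itself by 0, invariant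
    subspaces are ideals of [L], and minimality of [I] gives irreducibility. *)
Lemma core_free_class_II (I : {vspace L}) :
  is_ideal I -> commutative_on I -> I <> 0%VS -> in_class_II L.
Proof.
move=> idI comI I0; have [sM _ _] := maxM.
have MI0 : (M :&: I = 0)%VS by apply: (core_free_cap maxM coreM idI idI).
have IM0 : (I :&: M = 0)%VS by rewrite capvC.
have MI := core_free_sup maxM coreM idI I0.
pose p := daddv_pi M I; pose q := daddv_pi I M.
have pqE x : x = p x + q x by rewrite daddv_pi_add // MI memvf.
have pM x : p x \in M by exact: memv_pi.
have qI x : q x \in I by exact: memv_pi.
have pE m i : m \in M -> i \in I -> p (m + i) = m by exact: daddv_pi_unique.
have qE m i : m \in M -> i \in I -> q (m + i) = i.
  by rewrite addrC => mM iI; apply: daddv_pi_unique.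
have lieE x y : [lie x, y] = [lie p x, p y] + ([lie p x, q y] - [lie p y, q x]).
  rewrite {1}[x]pqE {1}[y]pqE lieDl !lieDr (comI (q x) (q y)) // addr0.
  by rewrite -addrA [ [lie q x, p y] ]lieC.
have p_lie x y : p [lie x, y] = [lie p x, p y].
  by rewrite lieE pE ?sM // memvB // (idI).
have q_lie x y : q [lie x, y] = [lie p x, q y] - [lie p y, q x].
  by rewrite lieE qE ?sM // memvB // (idI).
pose X := subvs_of I.
pose act := linfun (ideal_act I).
have actE x : act x = ideal_act I x by rewrite lfunE.
have sN : is_subalgebra (act @: M)%VS.
  move=> _ _ /memv_imgP[x xM ->] /memv_imgP[y yM ->].
  by rewrite !actE -ideal_act_lie // -actE memv_img // sM.
pose N : operatorLieAlg X := LieSubalg sN.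
(* The kernel of the action in [M] is an ideal of [L]: [I] centralizes it and [M] preserves it. *)
have act_ker : (M :&: lker act = 0)%VS.
  apply: coreM (capvSl _ _) => x y /memv_capP[yM]; rewrite memv_ker actE => /eqP y0.
  have yI z : z \in I -> [lie z, y] = 0.
    move=> zI; rewrite lieC -(vsprojK zI) -val_ideal_act // y0 zero_lfunE.
    exact: oppr0.
  rewrite [x]pqE lieDl (yI (q x)) // addr0; apply/memv_capP; split; first exact: sM.
  by rewrite memv_ker actE ideal_act_lie // y0 liex0.
pose f x : semidirect N := (vsproj N (act (p x)), vsproj I (q x)).
have homP (V : vectType F) (g : 'Hom(L, V)) a x y : g (a *: x + y) = a *: g x + g y.
  exact: linearP.
have f_lin : linear f.
  move=> a x y; rewrite /f !homP.
  by rewrite (linearP (vsproj N) a (act (p x))) (linearP (vsproj I) a (q x)).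
pose fl : {linear L -> semidirect N} := HB.pack f (GRing.isLinear.Build F L _ _ f f_lin).
have actN x : act (p x) \in (N : {vspace _}) by rewrite memv_img.
exists X, N; split.
  move=> Y Yinv.
  have idY : is_ideal (subvs_lift Y).
    move=> x _ /subvs_liftP[u uY ->]; rewrite [x]pqE lieDl.
    rewrite (comI (q x)) ?subvsP // addr0 -val_ideal_act //.
    apply/subvs_liftP; exists (ideal_act I (p x) u) => //.
    by rewrite (subvP (Yinv _ (actN x))) // actE memv_img.
  have [] := core_free_minimal maxM coreM MI0 idY (subvs_lift_sub Y).
    by move/subvs_lift_eq0; left.
  by move/subvs_lift_full; right.
exists fl; split=> [|x y]; last first.
  congr pair; apply: val_inj; rewrite /= !vsprojK //.
    by rewrite !actE p_lie ideal_act_lie.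
  by rewrite !actE !val_ideal_act // !vsprojK // q_lie.
apply: injective_linear_bijective.
  apply: raddf_inj => x [/(congr1 vsval) /= px0 /(congr1 vsval) /= qx0].
  rewrite !vsprojK // in px0 qx0.
  rewrite [x]pqE qx0 addr0; apply/eqP; rewrite -memv0 -act_ker.
  by apply/memv_capP; rewrite memv_ker px0.
rewrite -[in LHS]MI dimv_disjoint_sum // dimvf.
by rewrite -(limg_dim_eq act_ker).
Qed.

End ClassII.

(** * The converse: suitable maximal subalgebras in the three cases *)

Section CoreFreeTransfer.
Variables (F : fieldType).

Definition has_core_free_maximal (L : lieAlgType F) : Prop :=
  exists M, is_maximal_subalgebra M /\
    forall U : {vspace L}, is_ideal U -> (U <= M)%VS -> U = 0%VS.

Lemma core_free_maximal_iso (L L' : lieAlgType F) : lie_isomorphic L L' ->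
  has_core_free_maximal L' -> has_core_free_maximal L.
Proof.
move=> [f [f_bij f_lie]] [M [[sM Mproper Mmax] coreM]].
pose g := linfun f; have gE x : g x = f x by rewrite lfunE.
have gker : lker g == 0%VS.
  by apply/lker0P => x y; rewrite !gE; apply: bij_inj.
have gim : limg g = fullv.
  apply/eqP; rewrite eqEsubv subvf; apply/subvP => y _.
  by have [h _ fh] := f_bij; rewrite -(fh y) -gE memv_img ?memvf.
have gpre W : (g @: (g @^-1: W) = W)%VS by rewrite lpreimK // gim subvf.
have g_lie x y : g [lie x, y] = [lie g x, g y] by rewrite !gE f_lie.
have gsub K : is_subalgebra K -> is_subalgebra (g @: K)%VS.
  move=> sK _ _ /memv_imgP[x xK ->] /memv_imgP[y yK ->].
  by rewrite -g_lie memv_img // sK.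
exists (g @^-1: M)%VS; split.
  split=> [x y||K sK MK].
  - by rewrite -!memv_preim g_lie; apply: sM.
  - by move=> Mfull; apply: Mproper; rewrite -(gpre M) Mfull gim.
  - have MgK : (M <= g @: K)%VS by rewrite -(gpre M) limgS.
    have [e|e] := Mmax _ (gsub K sK) MgK; [left|right]; apply/eqP.
      by rewrite -(eq_limg_ker0 _ _ gker) e gpre.
    by rewrite -(eq_limg_ker0 _ _ gker) e gim.
move=> U idU UM; apply/eqP; rewrite -(eq_limg_ker0 _ _ gker) limg0; apply/eqP.
apply: coreM; last by rewrite -(gpre M) limgS.
move=> y' _ /memv_imgP[x xU ->]; have: y' \in limg g by rewrite gim memvf.
by move=> /memv_imgP[y _ ->]; rewrite -g_lie memv_img // idU.
Qed.

(** Any maximal proper subalgebra works; one exists because 0 is proper, [L] being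
    non-commutative. *)
Lemma simple_core_free (L : lieAlgType F) : is_simple L -> has_core_free_maximal L.
Proof.
move=> [ncL simL].
have [|M [[sM Mproper] Mmax]] := @exists_maximal_vspace _ _
    (fun M : {vspace L} => is_subalgebra M /\ M <> fullv) 0%VS.
  split=> [x y|full0].
    by rewrite !memv0 => /eqP -> _; rewrite lie0x.
  by apply: ncL => x y; rewrite -full0 memv0 => /eqP -> _; rewrite lie0x.
exists M; split.
  split=> // K sK MK; have [->|/eqP K_proper] := eqVneq K fullv; first by right.
  by left; apply: Mmax.
move=> U idU UM; have [//|Ufull] := simL U idU.
by case: Mproper; apply/eqP; rewrite eqEsubv subvf -Ufull.
Qed.

Lemma simple_center0 (L : lieAlgType F) (x : L) : is_simple L ->
  (forall y, [lie y, x] = 0) -> x = 0.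
Proof.
move=> [ncL simL] xC.
have [||Z ZP] := @vspace_comprehension _ _ (fun x : L => forall y, [lie y, x] = 0).
- by move=> y; rewrite liex0.
- by move=> a u v uC vC y; rewrite lieDr lieZr uC vC scaler0 addr0.
have idZ : is_ideal Z by move=> y z /ZP zC; rewrite zC mem0v.
have [Z0|Zfull] := simL Z idZ.
  by apply/eqP; rewrite -memv0 -Z0; apply/ZP.
by case: ncL => y z _; rewrite -Zfull => /ZP.
Qed.

(** The diagonal is maximal: a subalgebra [K] above it is determined by the [x] with [(0, x)] in
    [K], and these form an ideal of [N]. *)
Lemma dsum_core_free (N : lieAlgType F) : is_simple N ->
  has_core_free_maximal (N * N)%type.
Proof.
move=> simN; have [ncN idN] := simN.
have [||D DP] := @vspace_comprehension _ (N * N)%type (fun u => u.1 = u.2).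
- by [].
- by move=> a [u u'] [v v'] /= -> ->.
exists D; split; last first.
  move=> U idU UD; apply/eqP; rewrite -subv0; apply/subvP => u uU.
  have u12 := (DP u).1 (subvP UD u uU).
  suff u10 : u.1 = 0 by rewrite memv0 [u]surjective_pairing -u12 u10.
  apply: (simple_center0 simN) => y.
  (* Bracketing with [(y, 0)] kills the second component; membership in [D] then kills the first. *)
  have := (DP _).1 (subvP UD _ (idU (y, 0) u uU)).
  by rewrite /= lie0x.
split=> [u v /DP uD /DP vD|Dfull|K sK DK].
- by apply/DP; rewrite /= uD vD.
- apply: ncN => x y _ _.
  have /DP /= -> : (x, 0 : N) \in D by rewrite Dfull memvf.
  exact: lie0x.
have KD x : (x, x) \in K by apply: (subvP DK); apply/DP.
have [||B BP] := @vspace_comprehension _ N (fun x => (0 : N, x) \in K).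
- exact: mem0v.
- move=> a x y xK yK; have := memvD (memvZ a xK) yK.
  by rewrite -[_ + _]/(a *: 0 + 0, a *: x + y) scaler0 addr0.
have idB : is_ideal B.
  move=> x y /BP yK; apply/BP; have := sK _ _ (KD x) yK.
  by rewrite -[ [lie _, _] ]/([lie x, 0], [lie x, y]) liex0.
have Ksplit u : (u \in K) = (u.2 - u.1 \in B).
  have uE : u = (u.1, u.1) + (0, u.2 - u.1).
    by rewrite -[RHS]/(u.1 + 0, u.1 + (u.2 - u.1)) addr0 addrC subrK -surjective_pairing.
  apply/idP/idP => [uK|/BP uB]; last by rewrite uE memvD.
  apply/BP; have := memvB uK (KD u.1).
  by rewrite {1}uE addrAC subrr add0r.
have [B0|Bfull] := idN B idB; [left|right]; apply/vspaceP => u.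
  rewrite Ksplit B0 memv0 subr_eq0; apply/eqP/idP => [e|/DP -> //].
  by apply/DP.
by rewrite Ksplit Bfull !memvf.
Qed.

(** The operator summand is maximal: a subalgebra above it is determined by the [x] with [(0, x)] in
    it, an invariant subspace. The vector [w] excludes [X = 0], which [is_irreducible] allows and
    for which the algebra is zero. *)
Lemma semidirect_core_free (X : vectType F) (N : operatorLieAlg X) (w : semidirect N) :
  is_irreducible N -> w <> 0 -> has_core_free_maximal (semidirect N).
Proof.
move=> irrN w0; have lf0 (g : 'End(X)) : g 0 = 0 by exact: linear0.
have [x0 x00] : exists x : X, x <> 0.
  apply: contrapT => noX; have X0 (x : X) : x = 0.
    by apply: contrapT => x0; apply: noX; exists x.
  apply: w0; rewrite [w]surjective_pairing; congr pair; last exact: X0.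
  by apply: val_inj; apply/lfunP => v; rewrite [RHS]X0 [LHS]X0.
have [||M MP] := @vspace_comprehension _ (semidirect N) (fun u => u.2 = 0).
- by [].
- by move=> a [u u'] [v v'] /= -> ->; rewrite scaler0 addr0.
exists M; split; last first.
  move=> U idU UM; apply/eqP; rewrite -subv0; apply/subvP => u uU.
  have u20 := (MP u).1 (subvP UM u uU).
  rewrite memv0 [u]surjective_pairing u20; apply/eqP; congr pair.
  apply: val_inj; apply/lfunP => x; rewrite zero_lfunE.
  (* The bracket of [(0, x)] with [(a, 0)] has second component [- a x], which must vanish. *)
  have := (MP _).1 (subvP UM _ (idU (0, x) u uU)).
  by rewrite /= zero_lfunE sub0r => /eqP; rewrite oppr_eq0 => /eqP.
split=> [u v /MP uM /MP vM|Mfull|K sK MK].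
- by apply/MP; rewrite /= uM vM !lf0 subr0.
- have /MP /= x00' : ((0, x0) : semidirect N) \in M by rewrite Mfull memvf.
  exact: x00.
have KM a : ((a, 0) : semidirect N) \in K by apply: (subvP MK); apply/MP.
have [||Y YP] := @vspace_comprehension _ X (fun x => ((0, x) : semidirect N) \in K).
- exact: mem0v.
- move=> a x y xK yK; have := memvD (memvZ a xK) yK.
  by rewrite -[_ + _]/((a *: 0 + 0, a *: x + y) : semidirect N) scaler0 addr0.
have Yinv a : a \in (N : {vspace _}) -> (a @: Y <= Y)%VS.
  move=> aN; apply/subvP => _ /memv_imgP[y /YP yK ->]; apply/YP.
  have := sK _ _ (KM (vsproj N a)) yK.
  rewrite -[ [lie _, _] ]/(([lie vsproj N a : lieSubalg_of N, 0],
    vsval (vsproj N a) y - vsval (0 : lieSubalg_of N) 0) : semidirect N).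
  by rewrite liex0 vsprojK // lf0 subr0.
have Ksplit (u : semidirect N) : (u \in K) = (u.2 \in Y).
  have uE : u = ((u.1, 0) : semidirect N) + (0, u.2).
    by rewrite -[RHS]/((u.1 + 0, 0 + u.2) : semidirect N) addr0 add0r -surjective_pairing.
  apply/idP/idP => [uK|/YP uY]; last by rewrite uE memvD.
  apply/YP; have := memvB uK (KM u.1).
  by rewrite {1}uE addrAC subrr add0r.
have [Y0|Yfull] := irrN Y Yinv; [left|right]; apply/vspaceP => u.
  rewrite Ksplit Y0 memv0; apply/eqP/idP => [e|/MP //].
  by apply/MP.
by rewrite Ksplit Yfull !memvf.
Qed.

End CoreFreeTransfer.

(** * The classification of subsimple Lie algebras of dimension at least two *)

Theorem theorem9p4 (R : realType) (L : lieAlgType R[i]%C)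
    (dim_ge2 : (2 <= \dim {: L})%N) :
  (is_subsimple L <-> (is_simple L \/ in_class_I L \/ in_class_II L)) /\
  (is_subsimple L ->
     (is_semisimple L -> ~ is_simple L -> in_class_I L) /\
     (~ is_simple L -> ~ is_semisimple L -> in_class_II L)).
Proof.
have subsimpleE : is_subsimple L <-> has_core_free_maximal L.
  by split=> [[d1|//]|]; [rewrite d1 in dim_ge2|right].
have toI : is_subsimple L -> is_semisimple L -> ~ is_simple L -> in_class_I L.
  move=> /subsimpleE[M [maxM coreM]] ssL nsimL.
  have ncL : ~ commutative_on {:L}.
    move=> /(ssL fullv (fun x y _ => memvf _)) /(congr1 (fun U => \dim U)).
    by rewrite dimv0 => d0; rewrite d0 in dim_ge2.
  have [I [idI I0 Ifull]] : exists I : {vspace L},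
      [/\ is_ideal I, I <> 0%VS & I <> fullv].
    apply: contrapT => noI; apply: nsimL; split=> // U idU.
    have [->|/eqP U0] := eqVneq U 0%VS; first by left.
    have [->|/eqP Ufull] := eqVneq U fullv; first by right.
    by case: noI; exists U.
  have [J [idJ IJ0 IJ]] := semisimple_ideal_compl ssL idI.
  apply: (core_free_class_I maxM coreM ssL idI idJ I0 _ IJ0 IJ) => J0.
  by apply: Ifull; rewrite -IJ J0 addv0.
have toII : is_subsimple L -> ~ is_semisimple L -> in_class_II L.
  move=> /subsimpleE[M [maxM coreM]] nssL.
  apply: contrapT => nII; apply: nssL => U idU comU; apply: contrapT => U0.
  by apply: nII; apply: (core_free_class_II maxM coreM idU comU U0).
split; last by move=> subL; split=> [|_]; [apply: toI|apply: toII].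
split=> [subL|].
  have [simL|nsimL] := EM (is_simple L); first by left.
  right; have [ssL|nssL] := EM (is_semisimple L).
    by left; apply: toI.
  by right; apply: toII.
rewrite subsimpleE => -[|[[N [simN isoL]]|[X [N [irrN isoL]]]]].
- exact: simple_core_free.
- exact: core_free_maximal_iso isoL (dsum_core_free simN).
apply: (core_free_maximal_iso isoL); have [f [/bij_inj f_inj _]] := isoL.
(* [vpick fullv] is a non-zero vector because [L] is not zero, and [f] is injective. *)
apply: (semidirect_core_free (w := f (vpick fullv))) => // /eqP.
rewrite raddf_eq0 // vpick0 => /eqP /(congr1 (fun U => \dim U)).
by rewrite dimv0 => d0; rewrite d0 in dim_ge2.
Qed.
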